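(* For an integer $N\ge2$ and $\rho,\tau,\lambda>0$, and for $\beta\in[0,\rho]$, let $$u(\beta)=\frac{(\rho-\beta)\left((N-1)\beta+\rho+\tau\right)}{(N\beta+\tau)\rho^2}-\frac1\rho-\frac1\tau-\frac{\lambda}{(N-1)\beta+\rho+\tau},$$ and let $\beta^*$ denote a maximizer of $u(\beta)$ over $\beta\in[0,\rho]$ subject to $u(\beta)\ge u^0=-\frac{\lambda}{\rho+\tau}=u(0)$. (1) Fix $\rho,\tau,\lambda$ with $\lambda>\frac{\rho+\tau}{\tau}$. As $N\to\infty$, it is profitable to collaborate: $$\beta^*=\sqrt{\frac{\lambda-1}{N}}\,\rho+o\left(\frac1{\sqrt N}\right),\qquad u(\beta^* )-u^0=\frac{\lambda}{\rho+\tau}-\frac1\tau+o(1).$$ (2) Fix $\rho,\tau,\lambda$ with $\lambda<\frac{\rho+\tau}{\tau}$. In the limit $N\to\infty$ it is unprofitable to collaborate: $\beta^*=0$ for all sufficiently large $N$. (3) Fix $N,\tau,\lambda$. In the limit $\rho\to\infty$ it is unprofitable to collaborate: $\beta^*=0$ for all sufficiently large $\rho$. (4) Fix $N,\tau,\lambda$. In the limit $\rho\to0$ it is unprofitable to collaborate: $\beta^*=0$ for all sufficiently small $\rho>0$.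
   Context: Setting (symmetric Bayesian mean estimation). A parameter $\mu\sim N(0,1/\tau)$ is drawn; each of $N$ clients holds $n$ samples i.i.d. $N(\mu,\sigma^2)$ given $\mu$ and reveals its sample mean plus $N(0,\alpha^2)$ noise, with common $\alpha$ and common accuracy weight $\lambda$. Here $\rho=n/\sigma^2$ and $\beta=\frac{1}{1/\rho+\alpha^2}\in[0,\rho]$ ($\beta=0$ is no participation). The utility $u$ is the negative of (squared data-reconstruction leakage plus $\lambda$ times the mean squared error of the best estimate of $\mu$), and $u^0$ is the utility of training alone. *)

(* Defs.v *)
From HB Require Import structures.
From mathcomp Require Import all_boot all_order all_algebra.
From mathcomp Require Import all_classical all_reals all_analysis.

Set Implicit Arguments.
Unset Strict Implicit.
Unset Printing Implicit Defensive.

Import Order.TTheory GRing.Theory Num.Theory.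
Import numFieldNormedType.Exports.

Local Open Scope classical_set_scope.
Local Open Scope ring_scope.

(* A client's utility in a group of [N] clients at the common participation level
   [b] = 1 / (1 / rho + alpha ^ 2), alpha ^ 2 being the variance of the revealed
   noise: [rho] is the number of samples per client over the variance of one
   sample, [tau] the prior precision and [lam] the weight on accuracy. All
   denominators are positive when [0 <= b], [0 < rho], [0 < tau], [2 <= N]. *)
Definition utility (R : realType) (N : nat) (rho tau lam b : R) : R :=
  (rho - b) * ((N%:R - 1) * b + rho + tau) / ((N%:R * b + tau) * rho ^+ 2)
  - 1 / rho - 1 / tau - lam / ((N%:R - 1) * b + rho + tau).

(* The utility of training alone. *)
Definition utility_alone (R : realType) (rho tau lam : R) : R :=
  - (lam / (rho + tau)).

Definition feasible (R : realType) (N : nat) (rho tau lam : R) : set R :=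
  [set b | 0 <= b <= rho /\
           utility_alone rho tau lam <= utility N rho tau lam b].

Definition is_optimal (R : realType) (N : nat) (rho tau lam b : R) : Prop :=
  feasible N rho tau lam b /\
  forall c, feasible N rho tau lam c ->
    utility N rho tau lam c <= utility N rho tau lam b.

(* Main.v *)
Require Import Defs.
From HB Require Import structures.
From mathcomp Require Import all_boot all_order all_algebra.
From mathcomp Require Import all_classical all_reals all_analysis.
From mathcomp Require Import ring lra.

Set Implicit Arguments.
Unset Strict Implicit.
Unset Printing Implicit Defensive.

Import Order.TTheory GRing.Theory Num.Theory.
Import numFieldNormedType.Exports.

Local Open Scope classical_set_scope.
Local Open Scope ring_scope.

(** Write S = (N-1) b + rho + tau and T = N b + tau, so that S = T + (rho - b) >= T
    on the feasible interval.  The gain u(b) - u(0) equals b times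
      lam (N-1) / ((rho+tau) S)
        - (tau (N-1) b + (N-1) rho^2 + (rho+tau)^2) / (tau T rho^2),
    and T <= S makes the second factor negative as soon as lam tau < rho + tau;
    this gives (2), for every N >= 2, and (3).  For small rho the cross-multiplied
    positive term is O(rho) while the negative one stays above tau^4, hence (4).

    For (1), the gain is lam/(rho+tau) - 1/tau minus the loss
      L(b) = lam/S + b/rho^2 - (rho-b)^2/(T rho^2),
    which behaves like k^2/(N b) + b/rho^2 with k^2 = lam - 1.  At
    b = k rho / sqrt N it is at most (2k + O(1/sqrt N)) / (rho sqrt N), so the
    optimal loss tends to 0.  Conversely, with N b + tau + rho = rho (sqrt N) z, a
    linear lower bound on L keeps z away from 0, and then a quadratic one gives
    k^2/z + z <= 2k + O(1/sqrt N), i.e. (z - k)^2 <= z O(1/sqrt N), so z -> k. *)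

(** * Closed forms of the gain over training alone *)

Lemma utility_gapE (R : realType) (N : nat) (rho tau lam b : R) :
  (2 <= N)%N -> 0 < rho -> 0 < tau -> 0 <= b ->
  utility N rho tau lam b - utility_alone rho tau lam =
  b * (lam * (N%:R - 1) / ((rho + tau) * ((N%:R - 1) * b + rho + tau))
       - (tau * (N%:R - 1) * b + (N%:R - 1) * rho ^+ 2 + (rho + tau) ^+ 2)
         / (tau * (N%:R * b + tau) * rho ^+ 2)).
Proof.
rewrite -(ler_nat R) /utility /utility_alone; move: N%:R => n n2 r0 t0 b0.
have S0 : 0 < (n - 1) * b + rho + tau by nra.
have T0 : 0 < n * b + tau by nra.
by field; rewrite !gt_eqF //; lra.
Qed.

Definition loss (R : realType) (N : nat) (rho tau lam b : R) : R :=
  lam / ((N%:R - 1) * b + rho + tau) + b / rho ^+ 2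
  - (rho - b) ^+ 2 / ((N%:R * b + tau) * rho ^+ 2).

Lemma utility_lossE (R : realType) (N : nat) (rho tau lam b : R) :
  (2 <= N)%N -> 0 < rho -> 0 < tau -> 0 <= b ->
  utility N rho tau lam b - utility_alone rho tau lam =
  lam / (rho + tau) - 1 / tau - loss N rho tau lam b.
Proof.
rewrite -(ler_nat R) /utility /utility_alone /loss; move: N%:R => n n2 r0 t0 b0.
have S0 : 0 < (n - 1) * b + rho + tau by nra.
have T0 : 0 < n * b + tau by nra.
by field; rewrite !gt_eqF //; lra.
Qed.

Lemma utility0 (R : realType) (N : nat) (rho tau lam : R) :
  0 < rho -> 0 < tau ->
  utility N rho tau lam 0 = utility_alone rho tau lam.
Proof.
move=> r0 t0; rewrite /utility /utility_alone !mulr0 subr0 !add0r.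
by field; rewrite !gt_eqF //; lra.
Qed.

(** A maximizer over the whole interval, given by compactness, is automatically feasible: [0]
    competes with it and attains exactly [utility_alone]. *)
Lemma optimal_exists (R : realType) (N : nat) (rho tau lam : R) :
  (2 <= N)%N -> 0 < rho -> 0 < tau ->
  exists b : R, is_optimal N rho tau lam b.
Proof.
move=> N2 r0 t0.
have cu : {within `[0, rho], continuous (utility N rho tau lam)}.
  apply: continuous_in_subspaceT => x; rewrite inE /= in_itv /= => /andP[x0 xr].
  have n2 : (2 : R) <= N%:R by rewrite (ler_nat R).
  have S0 : (N%:R - 1) * x + rho + tau != 0 by rewrite gt_eqF//; nra.
  have T0 : (N%:R * x + tau) * rho ^+ 2 != 0.
    by rewrite gt_eqF// mulr_gt0 ?exprn_gt0//; nra.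
  have cS : {for x, continuous (fun y : R => (N%:R - 1) * y + rho + tau)}.
    apply: cvgD; last exact: cvg_cst.
    apply: cvgD; last exact: cvg_cst.
    by apply: cvgM; [exact: cvg_cst|exact: cvg_id].
  have cT : {for x, continuous (fun y : R => (N%:R * y + tau) * rho ^+ 2)}.
    apply: cvgM; last exact: cvg_cst.
    apply: cvgD; last exact: cvg_cst.
    by apply: cvgM; [exact: cvg_cst|exact: cvg_id].
  apply: cvgB; last by apply: cvgM; [exact: cvg_cst|exact: cvgV].
  apply: cvgB; last exact: cvg_cst.
  apply: cvgB; last exact: cvg_cst.
  apply: cvgM; last exact: cvgV.
  apply: cvgM; last exact: cS.
  by apply: cvgB; [exact: cvg_cst|exact: cvg_id].
have [c + cmax] := EVT_max (ltW r0) cu.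
rewrite in_itv /= => c0r; exists c; split.
  split => //; rewrite -(utility0 N lam r0 t0); apply: cmax.
  by rewrite in_itv /= lexx ltW.
by move=> d [d0r _]; apply: cmax; rewrite in_itv.
Qed.

(** * Regimes where no participation is optimal *)

Lemma optimal_eq0 (R : realType) (N : nat) (rho tau lam : R) :
  (forall b, 0 < b <= rho ->
     utility N rho tau lam b < utility_alone rho tau lam) ->
  forall b, is_optimal N rho tau lam b -> b = 0.
Proof.
move=> lt0 b [[/andP[b0 br] ub] _]; apply/eqP; rewrite eq_le b0 andbT leNgt.
apply/negP => bgt0.
by have := lt0 b; rewrite bgt0 br => /(_ isT); rewrite ltNge ub.
Qed.

(** The last hypothesis is negativity of the second factor in [utility_gapE], with its positive
    denominators cleared. *)
Lemma utility_lt_alone (R : realType) (N : nat) (rho tau lam b : R) :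
  (2 <= N)%N -> 0 < rho -> 0 < tau -> 0 < b ->
  lam * (N%:R - 1) * (tau * (N%:R * b + tau) * rho ^+ 2) <
  (tau * (N%:R - 1) * b + (N%:R - 1) * rho ^+ 2 + (rho + tau) ^+ 2)
    * ((rho + tau) * ((N%:R - 1) * b + rho + tau)) ->
  utility N rho tau lam b < utility_alone rho tau lam.
Proof.
move=> N2 r0 t0 b0 cross.
rewrite -subr_lt0 (utility_gapE _ N2 r0 t0 (ltW b0)) pmulr_rlt0// subr_lt0.
have n2 : (2 : R) <= N%:R by rewrite (ler_nat R).
rewrite ltr_pdivrMr; last by rewrite mulr_gt0//; nra.
by rewrite mulrAC ltr_pdivlMr// !mulr_gt0 ?exprn_gt0//; nra.
Qed.

Lemma unprofitable_small_lam (R : realType) (N : nat) (rho tau lam : R) :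
  (2 <= N)%N -> 0 < rho -> 0 < tau -> 0 < lam -> lam * tau < rho + tau ->
  forall b, is_optimal N rho tau lam b -> b = 0.
Proof.
move=> N2 r0 t0 l0 lt; apply: optimal_eq0 => b /andP[b0 br].
apply: utility_lt_alone => //.
have : (2 : R) <= N%:R by rewrite (ler_nat R).
move: N%:R => n n2.
set T := n * b + tau; set S := _ + rho + tau.
have T0 : 0 < T by rewrite /T; nra.
have TS : T <= S by rewrite /T /S; lra.
have r20 : 0 < (n - 1) * rho ^+ 2 by rewrite mulr_gt0 ?exprn_gt0//; lra.
(* The single summand [(n - 1) * rho ^+ 2] already suffices: it is a factor of the left side as
   well, and what remains is [lam * tau * T] against [(rho + tau) * S]. *)
apply: (@lt_le_trans _ _ ((n - 1) * rho ^+ 2 * ((rho + tau) * T))).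
  rewrite (_ : lam * _ * _ = (n - 1) * rho ^+ 2 * (lam * tau * T)); last by ring.
  by rewrite ltr_pM2l// ltr_pM2r.
apply: ler_pM; [exact: ltW|by rewrite ltW// mulr_gt0//; lra| |].
  have := sqr_ge0 (rho + tau); have : 0 <= tau * (n - 1) * b.
    by rewrite !mulr_ge0//; lra.
  lra.
by rewrite ler_pM2l//; lra.
Qed.

Lemma unprofitable_small_rho (R : realType) (N : nat) (rho tau lam : R) :
  (2 <= N)%N -> 0 < rho -> 0 < tau -> 0 < lam -> rho < 1 ->
  lam * (N%:R - 1) * (N%:R + tau) * rho < tau ^+ 3 ->
  forall b, is_optimal N rho tau lam b -> b = 0.
Proof.
move=> N2 r0 t0 l0 r1 lt; apply: optimal_eq0 => b /andP[b0 br].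
apply: utility_lt_alone => //.
have : (2 : R) <= N%:R by rewrite (ler_nat R).
move: N%:R lt => n lt n2.
have c0 : 0 < lam * (n - 1) by rewrite mulr_gt0//; lra.
have T0 : 0 < n * b + tau by nra.
have TT : n * b + tau <= n + tau by nra.
have rr : rho ^+ 2 <= rho by nra.
(* Since [b <= rho < 1], the left side has a bound linear in [rho] and free of [b]. *)
apply: (@le_lt_trans _ _ (tau * (lam * (n - 1) * (n + tau) * rho))).
  rewrite (_ : tau * (_ * _ * _ * _) = lam * (n - 1) * (tau * ((n + tau) * rho)));
    last by ring.
  rewrite ler_pM2l// -mulrA ler_pM2l//; apply: ler_pM => //.
    exact: ltW. exact: sqr_ge0.
apply: (@lt_le_trans _ _ (tau ^+ 2 * (tau * tau))).
  rewrite (_ : tau ^+ 2 * _ = tau * tau ^+ 3); last by ring.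
  by rewrite ltr_pM2l.
have p : 0 <= tau * (n - 1) * b by rewrite !mulr_ge0//; lra.
have q : 0 <= (n - 1) * rho ^+ 2 by rewrite mulr_ge0 ?sqr_ge0//; lra.
have w : 0 <= (n - 1) * b by rewrite mulr_ge0//; lra.
apply: ler_pM; [exact: sqr_ge0|nra|nra|].
by apply: ler_pM; lra.
Qed.

(** * Upper and lower bounds on the loss *)

(** After lowering S to T and expanding [(rho - b) ^+ 2], the term 1/T cancels one unit of [lam],
    which produces [lam - 1]; the cross term contributes at most [2 / (rho * N%:R)]. *)
Lemma loss_le (R : realType) (N : nat) (rho tau lam b : R) :
  (2 <= N)%N -> 0 < tau -> 1 <= lam -> 0 < b <= rho ->
  loss N rho tau lam b <=
  (lam - 1) / (N%:R * b) + b / rho ^+ 2 + 2 / (rho * N%:R).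
Proof.
rewrite -(ler_nat R) /loss; move: N%:R => n n2 t0 l1 /andP[b0 br].
have r0 : 0 < rho by lra.
have nb0 : 0 < n * b by rewrite mulr_gt0//; lra.
set S := _ + rho + tau; set T := n * b + tau.
have T0 : 0 < T by rewrite /T; lra.
have TS : T <= S by rewrite /T /S; lra.
have S0 : 0 < S by lra.
have h1 : lam / S <= lam / T.
  by rewrite ler_pM2l; [rewrite lef_pV2 ?posrE//|lra].
have h2 : (lam - 1) / T <= (lam - 1) / (n * b).
  by apply: ler_wpM2l; [lra|rewrite lef_pV2 ?posrE// /T; lra].
have h3 : b / T <= 1 / n.
  by rewrite ler_pdivrMr// mul1r mulrC ler_pdivlMr /T; nra.
have h4 : 2 / rho * (b / T) <= 2 / rho * (1 / n).
  by rewrite ler_pM2l// divr_gt0.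
have -> : (rho - b) ^+ 2 / (T * rho ^+ 2) =
    1 / T - 2 / rho * (b / T) + b ^+ 2 / (T * rho ^+ 2).
  by field; rewrite !gt_eqF.
have : 0 <= b ^+ 2 / (T * rho ^+ 2).
  by rewrite divr_ge0 ?sqr_ge0// mulr_ge0 ?sqr_ge0// ltW.
have : 2 / rho * (1 / n) = 2 / (rho * n) by field; rewrite !gt_eqF//; lra.
have : lam / T = (lam - 1) / T + 1 / T by field; rewrite gt_eqF.
lra.
Qed.

Lemma loss_ge (R : realType) (N : nat) (rho tau lam b : R) :
  (2 <= N)%N -> 0 < rho -> 0 < tau -> 0 <= lam -> 0 <= b <= rho ->
  lam / (N%:R * b + tau + rho) - 1 / (N%:R * b + tau) + b / rho ^+ 2
  <= loss N rho tau lam b.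
Proof.
rewrite -(ler_nat R) /loss; move: N%:R => n n2 r0 t0 l0 /andP[b0 br].
have nb0 : 0 <= (n - 1) * b by rewrite mulr_ge0//; lra.
have h1 : lam / (n * b + tau + rho) <= lam / ((n - 1) * b + rho + tau).
  by apply: ler_wpM2l => //; rewrite lef_pV2 ?posrE; lra.
have T0 : 0 < n * b + tau by lra.
have h2 : (rho - b) ^+ 2 / ((n * b + tau) * rho ^+ 2) <= 1 / (n * b + tau).
  have -> : 1 / (n * b + tau) = rho ^+ 2 / ((n * b + tau) * rho ^+ 2).
    by field; rewrite !gt_eqF.
  apply: ler_wpM2r; last by nra.
  by rewrite invr_ge0 mulr_ge0 ?sqr_ge0 ?ltW.
lra.
Qed.

(** Compares 1/(c+tau) with a multiple of 1/(c+tau+rho), the ratio being largest at c = 0. The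
    resulting coefficient is not sharp, but it is positive exactly when [lam] exceeds the threshold
    (rho+tau)/tau. *)
Lemma loss_ge_linear (R : realType) (N : nat) (rho tau lam b : R) :
  (2 <= N)%N -> 0 < rho -> 0 < tau -> 0 <= lam -> 0 <= b <= rho ->
  (lam - 1 - rho / tau) / (N%:R * b + tau + rho) <= loss N rho tau lam b.
Proof.
move=> N2 r0 t0 l0 b0r; apply: le_trans (loss_ge N2 r0 t0 l0 b0r).
case/andP: b0r => b0 br.
have nb0 : 0 <= N%:R * b by rewrite mulr_ge0.
move: (N%:R * b) nb0 => c c0.
have : 1 / (c + tau) <= (1 + rho / tau) / (c + tau + rho).
  rewrite ler_pdivrMr; last by lra.
  rewrite mulrAC ler_pdivlMr; last by lra.
  have -> : (1 + rho / tau) * (c + tau) = c + tau + rho + rho / tau * c.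
    by field; rewrite gt_eqF.
  have : 0 <= rho / tau * c by rewrite mulr_ge0// divr_ge0 ?ltW.
  lra.
have : 0 <= b / rho ^+ 2 by rewrite divr_ge0 ?sqr_ge0.
have -> : (lam - 1 - rho / tau) / (c + tau + rho) =
  lam / (c + tau + rho) - (1 + rho / tau) / (c + tau + rho) by ring.
lra.
Qed.

(** With T = N b + tau and W = T + rho, one has 1/T = 1/W + rho/(T W) and 1/T <= (tau+rho)/(tau W).
    The leading coefficient [lam - 1] is now sharp, at the price of an error of order 1/W^2. *)
Lemma loss_ge_quadratic (R : realType) (N : nat) (rho tau lam b : R) :
  (2 <= N)%N -> 0 < rho -> 0 < tau -> 0 <= lam -> 0 <= b <= rho ->
  (lam - 1) / (N%:R * b + tau + rho)
    - rho * (tau + rho) / tau / (N%:R * b + tau + rho) ^+ 2 + b / rho ^+ 2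
  <= loss N rho tau lam b.
Proof.
move=> N2 r0 t0 l0 b0r; apply: le_trans (loss_ge N2 r0 t0 l0 b0r).
case/andP: b0r => b0 br.
have nb0 : 0 <= N%:R * b by rewrite mulr_ge0.
move: (N%:R * b) nb0 => c c0; rewrite lerD2r.
have T0 : 0 < c + tau by lra.
have W0 : 0 < c + tau + rho by lra.
have -> : 1 / (c + tau) = 1 / (c + tau + rho)
    + rho / tau * (tau / (c + tau)) / (c + tau + rho).
  by field; rewrite !gt_eqF.
have -> : rho * (tau + rho) / tau / (c + tau + rho) ^+ 2 =
  rho / tau * ((tau + rho) / (c + tau + rho)) / (c + tau + rho).
  by field; rewrite !gt_eqF.
have : rho / tau * (tau / (c + tau)) / (c + tau + rho) <=
    rho / tau * ((tau + rho) / (c + tau + rho)) / (c + tau + rho).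
  apply: ler_wpM2r; first by rewrite invr_ge0 ltW.
  apply: ler_wpM2l; first by rewrite divr_ge0 ?ltW.
  by rewrite ler_pdivrMr// mulrAC ler_pdivlMr//; nra.
lra.
Qed.

(** * Rescaling by sqrt N *)

(** The guess balances the two main terms of [loss_le]: k^2/(N b) and b/rho^2 both become k/(rho s).
    The condition [k <= s] keeps it within [rho]. *)
Lemma loss_guess_le (R : realType) (N : nat) (rho tau k s : R) :
  (2 <= N)%N -> 0 < rho -> 0 < tau -> 0 < k -> k <= s -> s ^+ 2 = N%:R ->
  loss N rho tau (k ^+ 2 + 1) (k / s * rho) <= (2 * k + 2 / s) / (rho * s).
Proof.
move=> N2 r0 t0 k0 ks sN.
have s0 : 0 < s by lra.
have b0r : 0 < k / s * rho <= rho.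
  rewrite mulr_gt0 ?divr_gt0//= -[leRHS]mul1r ler_pM2r//.
  by rewrite ler_pdivrMr// mul1r.
have l1 : 1 <= k ^+ 2 + 1 by rewrite lerDr sqr_ge0.
apply: le_trans (loss_le N2 t0 l1 b0r) _; rewrite -sN.
rewrite le_eqVlt; apply/orP; left; apply/eqP.
by field; rewrite !gt_eqF.
Qed.

(** With y = |z - k|, the bound z <= k + y gives y^2/(k+y) <= h <= e^2/(k+e), and t^2/(k+t)
    increases with t. *)
Lemma near_of_sqr_le (R : realFieldType) (z k h e : R) :
  0 < k -> 0 <= h -> 0 < e -> (z - k) ^+ 2 <= z * h -> h * (k + e) <= e ^+ 2 ->
  `|z - k| <= e.
Proof.
move=> k0 h0 e0 zh he; rewrite leNgt; apply/negP => ey.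
have zk : z <= k + `|z - k| by have := ler_norm (z - k); lra.
rewrite -real_normK ?num_real// in zh.
move: (`|z - k|) ey zk zh => y ey zk zh.
have : y ^+ 2 <= (k + y) * h by apply: le_trans zh _; rewrite ler_wpM2r.
have : 0 < k * (y ^+ 2 - e ^+ 2) by rewrite mulr_gt0// subr_gt0 ltrXn2r//; lra.
have : 0 < y * e * (y - e) by rewrite !mulr_gt0//; lra.
nra.
Qed.

(* [rho * s * z] is the value of [N * b + tau + rho], where [s = sqrt N]. *)
Lemma scaled_loss_bound (R : realType) (N : nat) (rho tau k s b z d : R) :
  (2 <= N)%N -> 0 < rho -> 0 < tau -> 0 < k -> 1 <= s -> s ^+ 2 = N%:R ->
  0 <= b <= rho -> 0 < d -> d <= k ^+ 2 - rho / tau ->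
  z = (N%:R * b + tau + rho) / (rho * s) ->
  loss N rho tau (k ^+ 2 + 1) b <= (2 * k + 2 / s) / (rho * s) ->
  (z - k) ^+ 2 <= z * ((2 + (tau + rho) / tau / (d / (2 * k + 2)) ^+ 2
                          + (tau + rho) / rho) / s).
Proof.
move=> N2 r0 t0 k0 s1 sN b0r d0 dk zE lossb.
have s0 : 0 < s by lra.
have rs0 : 0 < rho * s by rewrite mulr_gt0.
have l0 : 0 <= k ^+ 2 + 1 by rewrite addr_ge0 ?sqr_ge0.
have lin := loss_ge_linear N2 r0 t0 l0 b0r.
have quad := loss_ge_quadratic N2 r0 t0 l0 b0r.
have WE : N%:R * b + tau + rho = rho * s * z.
  by rewrite zE [RHS]mulrC divfK// gt_eqF.
have bE : b = (rho * s * z - tau - rho) / s ^+ 2.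
  by rewrite -WE sN; field; rewrite pnatr_eq0 -lt0n (leq_trans _ N2).
have z0 : 0 < z.
  rewrite zE divr_gt0//; case/andP: b0r => b0 _.
  have : 0 <= N%:R * b by rewrite mulr_ge0.
  lra.
rewrite WE in lin quad.
have ks : 2 * k + 2 / s <= 2 * k + 2.
  by rewrite lerD2l ler_pdivrMr//; lra.
(* The linear bound keeps [z] away from 0, uniformly in [s >= 1]. *)
have zm : d / (2 * k + 2) <= z.
  rewrite ler_pdivrMr; last by lra.
  have := le_trans lin lossb.
  rewrite ler_pdivrMr; last by rewrite mulr_gt0.
  have -> : (2 * k + 2 / s) / (rho * s) * (rho * s * z) = z * (2 * k + 2 / s).
    by field; rewrite !gt_eqF.
  have : z * (2 * k + 2 / s) <= z * (2 * k + 2) by rewrite ler_pM2l.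
  lra.
have : 0 < d / (2 * k + 2) by rewrite divr_gt0//; lra.
move: (d / (2 * k + 2)) zm => m zm m0.
have := le_trans quad lossb; rewrite {1}bE => {}quad.
(* Multiplying by [z * (rho * s)] turns the main terms into k^2 + z^2 <= 2 k z, which completes the
   square. *)
have : z * (rho * s) * ((k ^+ 2 + 1 - 1) / (rho * s * z)
    - rho * (tau + rho) / tau / (rho * s * z) ^+ 2
    + (rho * s * z - tau - rho) / s ^+ 2 / rho ^+ 2)
  <= z * (rho * s) * ((2 * k + 2 / s) / (rho * s)).
  by rewrite ler_pM2l// mulr_gt0.
have -> : z * (rho * s) * ((2 * k + 2 / s) / (rho * s)) = 2 * k * z + z * (2 / s).
  by field; rewrite !gt_eqF.
have -> : z * (rho * s) * ((k ^+ 2 + 1 - 1) / (rho * s * z)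
    - rho * (tau + rho) / tau / (rho * s * z) ^+ 2
    + (rho * s * z - tau - rho) / s ^+ 2 / rho ^+ 2) =
  k ^+ 2 + z ^+ 2 - z * ((tau + rho) / tau / z ^+ 2 / s)
  - z * ((tau + rho) / rho / s).
  by field; rewrite !gt_eqF.
(* The lower bound [m] on [z] makes the error constant independent of [z]. *)
have : z * ((tau + rho) / tau / z ^+ 2 / s) <=
       z * ((tau + rho) / tau / m ^+ 2 / s).
  rewrite ler_pM2l// ler_pM2r ?invr_gt0// ler_pM2l; last by rewrite divr_gt0//; lra.
  by rewrite lef_pV2 ?posrE ?exprn_gt0// lerXn2r// nnegrE ltW.
rewrite !(mulrDl _ _ s^-1) !mulrDr.
nra.
Qed.

(** * Asymptotics of the optimum as N grows *)

Lemma optimal_loss_le (R : realType) (N : nat) (rho tau lam b c : R) :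
  (2 <= N)%N -> 0 < rho -> 0 < tau -> is_optimal N rho tau lam b ->
  0 <= c <= rho -> loss N rho tau lam c <= lam / (rho + tau) - 1 / tau ->
  loss N rho tau lam b <= loss N rho tau lam c.
Proof.
move=> N2 r0 t0 [[/andP[b0 br] ub] bmax] /andP[c0 cr] lc.
have uc := utility_lossE lam N2 r0 t0 c0.
have -> : loss N rho tau lam b <= loss N rho tau lam c =
          (utility N rho tau lam c <= utility N rho tau lam b).
  have := utility_lossE lam N2 r0 t0 b0; move=> ?; apply/idP/idP; lra.
by apply: bmax; split; [rewrite c0 cr|lra].
Qed.

Lemma near_infty_sqrt_gt (R : realType) (M : R) :
  \forall N \near \oo, M < Num.sqrt (N%:R : R).
Proof.
near=> N; apply: le_lt_trans (ler_norm M) _.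
rewrite -sqrtr_sqr ltr_sqrt.
  by near: N; exact: nbhs_infty_gtr.
by rewrite ltr0n; near: N; exact: nbhs_infty_gt.
Unshelve. all: by end_near. Qed.

Lemma optimal_loss_bound (R : realType) (rho tau k e : R) (bs : nat -> R)
    (lam := k ^+ 2 + 1) (s := fun N : nat => Num.sqrt (N%:R : R)) :
  0 < rho -> 0 < tau -> 0 < k -> rho / tau < k ^+ 2 ->
  (forall N, (2 <= N)%N -> is_optimal N rho tau lam (bs N)) ->
  0 < e -> \forall N \near \oo,
  [/\ 0 < loss N rho tau lam (bs N) < e,
      loss N rho tau lam (bs N) <= (2 * k + 2 / s N) / (rho * s N) &
      utility N rho tau lam (bs N) - utility_alone rho tau lam =
      lam / (rho + tau) - 1 / tau - loss N rho tau lam (bs N)].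
Proof.
move=> r0 t0 k0 ltk bs_opt e0.
have gain_gt0 : 0 < lam / (rho + tau) - 1 / tau.
  rewrite subr_gt0 ltr_pdivrMr// mulrAC ltr_pdivlMr; last by lra.
  by move: ltk; rewrite ltr_pdivrMr// /lam; lra.
near=> N.
have N2 : (2 <= N)%N by near: N; exact: nbhs_infty_ge.
have ks : k < s N by near: N; exact: near_infty_sqrt_gt.
have s1 : 1 < s N by near: N; exact: near_infty_sqrt_gt.
have es : (2 * k + 2) / (rho * e) < s N by near: N; exact: near_infty_sqrt_gt.
(* This threshold puts the loss of the guess below the limiting gain, so that the guess is feasible
   and can be compared with the optimum. *)
have Cs : (2 * k + 2) / (rho * (lam / (rho + tau) - 1 / tau)) < s N.
  by near: N; exact: near_infty_sqrt_gt.
have [[/andP[b0 br] _] _] := bs_opt _ N2.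
have bnd M : 0 < M -> (2 * k + 2) / (rho * M) < s N ->
    (2 * k + 2 / s N) / (rho * s N) < M.
  move=> M0; rewrite ltr_pdivrMr ?mulr_gt0// => Ms.
  rewrite ltr_pdivrMr; last by rewrite mulr_gt0//; lra.
  apply: le_lt_trans (_ : 2 * k + 2 < _); last by lra.
  by rewrite lerD2l ler_pdivrMr//; lra.
have guess : loss N rho tau lam (k / s N * rho) <= (2 * k + 2 / s N) / (rho * s N).
  by apply: loss_guess_le => //; [exact: ltW|exact: sqr_sqrtr].
have upper : loss N rho tau lam (bs N) <= (2 * k + 2 / s N) / (rho * s N).
  apply: (le_trans _ guess); apply: optimal_loss_le => //; first exact: bs_opt.
    have -> : 0 <= k / s N * rho by rewrite ltW// mulr_gt0// divr_gt0//; lra.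
    rewrite -[leRHS]mul1r ler_pM2r// ler_pdivrMr; lra.
  by apply: (le_trans guess); apply/ltW/bnd.
split => //.
  rewrite (le_lt_trans upper (bnd _ e0 es)) andbT.
  apply: lt_le_trans (loss_ge_linear N2 r0 t0 _ _); [|by rewrite /lam; nra|by rewrite b0].
  have Nb : 0 <= N%:R * bs N by rewrite mulr_ge0.
  by rewrite divr_gt0// /lam; lra.
exact: utility_lossE.
Unshelve. all: by end_near. Qed.

Lemma optimal_participation_near (R : realType) (rho tau k e : R)
    (bs : nat -> R) (s := fun N : nat => Num.sqrt (N%:R : R)) :
  0 < rho -> 0 < tau -> 0 < k -> rho / tau < k ^+ 2 ->
  (forall N, (2 <= N)%N -> is_optimal N rho tau (k ^+ 2 + 1) (bs N)) ->
  0 < e -> \forall N \near \oo,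
  `|bs N - k / s N * rho| <= e * `|1 / s N|.
Proof.
move=> r0 t0 k0 ltk bs_opt e0.
pose d := k ^+ 2 - rho / tau; have d0 : 0 < d by rewrite subr_gt0.
pose K := 2 + (tau + rho) / tau / (d / (2 * k + 2)) ^+ 2 + (tau + rho) / rho.
have K0 : 0 < K.
  rewrite !addr_gt0// ?divr_gt0 ?exprn_gt0 ?divr_gt0//; lra.
(* Half of [e] pays for [rho * (z - k)], the other half for the shift by [tau + rho] in the
   definition of [z]. *)
pose e1 := e / (2 * rho).
have e10 : 0 < e1 by rewrite divr_gt0// mulr_gt0.
near=> N.
have N2 : (2 <= N)%N by near: N; exact: nbhs_infty_ge.
have s1 : 1 < s N by near: N; exact: near_infty_sqrt_gt.
have Ks : K * (k + e1) / e1 ^+ 2 < s N by near: N; exact: near_infty_sqrt_gt.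
have es : (tau + rho) / (e / 2) < s N by near: N; exact: near_infty_sqrt_gt.
have s0 : 0 < s N by lra.
have [[b0r _] _] := bs_opt _ N2.
have lossb : loss N rho tau (k ^+ 2 + 1) (bs N) <=
    (2 * k + 2 / s N) / (rho * s N).
  near: N; apply: filterS (optimal_loss_bound r0 t0 k0 ltk bs_opt ltr01).
  by move=> N [].
pose z := (N%:R * bs N + tau + rho) / (rho * s N).
have zk : `|z - k| <= e1.
  apply: (@near_of_sqr_le _ _ _ (K / s N)) => //.
  - by rewrite divr_ge0 ?ltW.
  - apply: (scaled_loss_bound N2 r0 t0 k0 (ltW s1) _ b0r d0) => //.
    exact: sqr_sqrtr.
  - have e2 : 0 < e1 ^+ 2 by rewrite exprn_gt0.
    move: Ks; rewrite (ltr_pdivrMr _ _ e2) => Ks.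
    by rewrite mulrAC ler_pdivrMr// ltW// [ltRHS]mulrC.
have -> : bs N - k / s N * rho = (rho * (z - k) - (tau + rho) / s N) / s N.
  have sN : s N ^+ 2 = N%:R by exact: sqr_sqrtr.
  by rewrite /z -sN; field; rewrite !gt_eqF.
rewrite normrM div1r; apply: ler_wpM2r => //.
apply: le_trans (ler_normB _ _) _.
rewrite normrM (gtr0_norm r0) [`|_ / _|]gtr0_norm; last by rewrite divr_gt0//; lra.
have -> : e = rho * e1 + e / 2 by rewrite /e1; field; rewrite gt_eqF.
apply: lerD; first by rewrite ler_pM2l.
by move: es; rewrite !ltr_pdivrMr ?divr_gt0// ler_pdivrMr//; lra.
Unshelve. all: by end_near. Qed.

(** * The limiting regimes *)

Theorem mainTheorem7 (R : realType) :
  (* u(0) = u^0, and maximizers exist *)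
  (forall (N : nat) (rho tau lam : R),
     (2 <= N)%N -> 0 < rho -> 0 < tau -> 0 < lam ->
     utility N rho tau lam 0 = utility_alone rho tau lam /\
     exists b : R, is_optimal N rho tau lam b) /\
  (* N -> oo, large lam *)
  (forall (rho tau lam : R), 0 < rho -> 0 < tau -> 0 < lam ->
     (rho + tau) / tau < lam ->
     forall bs : nat -> R,
     (forall N : nat, (2 <= N)%N -> is_optimal N rho tau lam (bs N)) ->
     [/\ \forall N \near \oo,
           utility_alone rho tau lam < utility N rho tau lam (bs N),
         bs = (fun N : nat => Num.sqrt ((lam - 1) / N%:R) * rho)
                +o_\oo (fun N : nat => 1 / Num.sqrt (N%:R : R))
       & (fun N : nat =>
            utility N rho tau lam (bs N) - utility_alone rho tau lam) =
         (fun _ : nat => lam / (rho + tau) - 1 / tau)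
           +o_\oo (fun _ : nat => 1 : R)]) /\
  (* N -> oo, small lam *)
  (forall (rho tau lam : R), 0 < rho -> 0 < tau -> 0 < lam ->
     lam < (rho + tau) / tau ->
     \forall N \near \oo,
       forall b : R, is_optimal N rho tau lam b -> b = 0) /\
  (* rho -> +oo *)
  (forall (N : nat) (tau lam : R), (2 <= N)%N -> 0 < tau -> 0 < lam ->
     \forall rho \near +oo,
       forall b : R, is_optimal N rho tau lam b -> b = 0) /\
  (* rho -> 0^+ *)
  (forall (N : nat) (tau lam : R), (2 <= N)%N -> 0 < tau -> 0 < lam ->
     \forall rho \near 0^'+,
       forall b : R, is_optimal N rho tau lam b -> b = 0).
Proof.
split.
  move=> N rho tau lam N2 r0 t0 l0.
  by split; [exact: utility0|exact: optimal_exists].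
split.
  move=> rho tau lam r0 t0 l0 ll bs opt.
  pose k := Num.sqrt (lam - 1).
  have lam_gt : rho / tau < lam - 1.
    by move: ll; rewrite mulrDl divff ?gt_eqF// ltrBrDr.
  have lam1_gt0 : 0 < lam - 1 by apply: lt_trans lam_gt; exact: divr_gt0.
  have k0 : 0 < k by rewrite sqrtr_gt0.
  have k2 : k ^+ 2 = lam - 1 by rewrite sqr_sqrtr// ltW.
  have lamE : lam = k ^+ 2 + 1 by rewrite k2 subrK.
  have ltk : rho / tau < k ^+ 2 by rewrite k2.
  have opt' N : (2 <= N)%N -> is_optimal N rho tau (k ^+ 2 + 1) (bs N).
    by rewrite -lamE; exact: opt.
  have := optimal_loss_bound r0 t0 k0 ltk opt'; rewrite -lamE => bound.
  have C0 : 0 < lam / (rho + tau) - 1 / tau.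
    rewrite subr_gt0 ltr_pdivrMr// mulrAC ltr_pdivlMr; last by lra.
    by move: ll; rewrite ltr_pdivrMr//; lra.
  split.
  - apply: filterS (bound _ C0) => N [/andP[_ lt] _ gapE].
    by rewrite -subr_gt0 gapE subr_gt0.
  - apply/eqaddoP => e e0.
    apply: filterS (optimal_participation_near r0 t0 k0 ltk opt' e0) => N.
    by rewrite /= !fctE sqrtrM ?sqrtrV// ltW.
  - apply/eqaddoP => e e0.
    apply: filterS (bound _ e0) => N [/andP[lpos lt] _ gapE].
    rewrite /= !fctE gapE addrAC subrr sub0r normrN normr1 mulr1.
    by rewrite gtr0_norm// ltW.
split.
  move=> rho tau lam r0 t0 l0 ll.
  near=> N; apply: unprofitable_small_lam => //.
    by near: N; exact: nbhs_infty_ge.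
  by move: ll; rewrite ltr_pdivlMr.
split.
  move=> N tau lam N2 t0 l0; near=> rho.
  have r0 : 0 < rho by near: rho; exact: nbhs_pinfty_gt.
  (* For fixed [lam], a large [rho] falls under the small-[lam] criterion. *)
  apply: unprofitable_small_lam => //.
  have : lam * tau < rho.
    by near: rho; apply: nbhs_pinfty_gt; exact: num_real.
  lra.
move=> N tau lam N2 t0 l0.
have N1 : 1 < N%:R :> R by rewrite ltr1n.
(* The coefficient of [rho] in the criterion of [unprofitable_small_rho], which then holds once
   [rho] is below [tau ^+ 3 / M]. *)
pose M := lam * (N%:R - 1) * (N%:R + tau).
have M0 : 0 < M by rewrite !mulr_gt0//; lra.
have e0 : 0 < tau ^+ 3 / M by rewrite divr_gt0// exprn_gt0.
near=> rho.
have r0 : 0 < rho by near: rho; exact: nbhs_right_gt.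
have r1 : rho < 1 by near: rho; exact: (nbhs_right_lt ltr01).
have re : rho < tau ^+ 3 / M by near: rho; exact: (nbhs_right_lt e0).
apply: unprofitable_small_rho => //.
by rewrite -/M mulrC -ltr_pdivlMr.
Unshelve. all: by end_near. Qed.
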